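(* Let $\mathfrak{C}, T,\mathfrak{d} \in (0,\infty)$, let $A_d\in C(\mathbb{R}^d,\mathbb{R}^d)$, $d\in\mathbb{N}$, satisfy for all $d\in \mathbb{N}$, $x=(x_1,\dots,x_d)\in\mathbb{R}^d$ that $A_d(x)=(\max\{x_1,0\},\dots,\max\{x_d,0\})$, let $$\mathbf{N}=\bigcup_{L \in \mathbb{N}}\ \bigcup_{(l_0,l_1,\ldots, l_L) \in \mathbb{N}^{L+1}}\Big(\times_{k = 1}^L (\mathbb{R}^{l_k \times l_{k-1}} \times \mathbb{R}^{l_k})\Big),$$ let $R\colon\mathbf{N}\to \cup_{k,l\in\mathbb{N}}\,C(\mathbb{R}^k,\mathbb{R}^l)$ and $P\colon\mathbf{N}\to \mathbb{N}$ satisfy for all $L\in\mathbb{N}$, $l_0,\ldots, l_L \in \mathbb{N}$, $\Phi \in \times_{k = 1}^L(\mathbb{R}^{l_k \times l_{k-1}} \times \mathbb{R}^{l_k})$, $\Psi =((W_1, B_1),\ldots, (W_L, B_L))\in \times_{k = 1}^L(\mathbb{R}^{l_k \times l_{k-1}} \times \mathbb{R}^{l_k})$, $x_0 \in \mathbb{R}^{l_0}, x_1 \in \mathbb{R}^{l_1}, \ldots, x_{L-1} \in \mathbb{R}^{l_{L-1}}$ with $\forall\, k \in \mathbb{N} \cap (0,L) \colon x_k =A_{l_k}(W_k x_{k-1} + B_k)$ that $P(\Phi)=\sum_{k = 1}^L l_k(l_{k-1} + 1)$, $R(\Psi) \in C(\mathbb{R}^{l_0},\mathbb{R}^{l_L})$,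 and $(R(\Psi))(x_0) = W_L x_{L-1} + B_L$. Let $\Phi_d\in \mathbf{N}$, $d\in\mathbb{N}$, satisfy for all $d\in\mathbb{N}$, $x\in \mathbb{R}^d$ that $R(\Phi_d)\in C(\mathbb{R}^d,\mathbb{R}^d)$, $\Vert (R(\Phi_d))(x)\Vert\le \mathfrak{C}(1+\Vert x\Vert)$, and $P(\Phi_d)\le \mathfrak{C}d^{\mathfrak{d}}$. Let $Y^{d,N}= (Y^{d,N}_{t,x})_{(t,x)\in [0,T]\times \mathbb{R}^d} \colon [0,T]\times \mathbb{R}^d \to \mathbb{R}^d$, $N, d\in \mathbb{N}$, be the functions which satisfy for all $d, N\in\mathbb{N}$, $n\in\{0,1,\dots,N-1\}$, $t \in [\frac{nT}{N},\frac{(n+1)T}{N}]$, $x \in \mathbb{R}^d$ that $Y^{d,N}_{0,x}=x$ and $$Y^{d,N}_{t,x} = Y^{d,N}_{\frac{nT}{N},x}+ \left(t-\tfrac{nT}{N}\right)(R(\Phi_d)) \big(Y^{d,N}_{\frac{nT}{N},x} \big).$$ Then there exist $C\in\mathbb{R}$ and $\Psi_{\varepsilon,d,N}\in \mathbf{N}$, $N, d\in \mathbb{N}$, $\varepsilon\in (0,1]$, such that (i) for all $\varepsilon\in (0,1]$, $d,N\in\mathbb{N}$: $R (\Psi_{\varepsilon,d,N})\in C(\mathbb{R}^{d+1},\mathbb{R}^d)$; (ii) for all $\varepsilon\in (0,1]$, $d,N\in\mathbb{N}$, $t \in [0,T]$, $x\in\mathbb{R}^d$: $\Vert Y^{d,N}_{t,x}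 -(R (\Psi_{\varepsilon,d,N}))(t,x)\Vert\le Cd^{1/2} N^{3/2}\varepsilon(1+\Vert x\Vert^3)$; (iii) for all $\varepsilon\in (0,1]$, $d,N\in\mathbb{N}$, $t \in [0,T]$, $x\in\mathbb{R}^d$: $\Vert (R (\Psi_{\varepsilon,d,N}))(t,x)\Vert \le Cd^{1/2}N(1+\Vert x\Vert^2)$; and (iv) for all $\varepsilon\in (0,1]$, $d,N\in\mathbb{N}$: $P(\Psi_{\varepsilon,d,N})\le Cd^{16+8\mathfrak{d}}N^6\big[1+|\ln(\varepsilon)|^2\big]$.
   Context: $\mathbb{N}=\{1,2,3,\dots\}$; $\Vert\cdot\Vert$ denotes the Euclidean norm on $\mathbb{R}^d$ for every $d\in\mathbb{N}$. $C(X,Y)$ is the set of continuous functions from $X$ to $Y$. *)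

(* Defs.v *)
From HB Require Import structures.
From mathcomp Require Import all_boot all_order all_algebra.
From mathcomp Require Import all_classical all_reals all_analysis.
Set Implicit Arguments.
Unset Strict Implicit.
Unset Printing Implicit Defensive.
Import Order.TTheory GRing.Theory Num.Theory.
Import numFieldNormedType.Exports.
Local Open Scope ring_scope.

(* The library norm on matrices is the sup norm, hence this definition. *)
Definition enorm (R : realType) (d : nat) (x : 'cV[R]_d) : R :=
  Num.sqrt (\sum_(i < d) x i 0 ^+ 2).

Definition relu (R : realType) (d : nat) (x : 'cV[R]_d) : 'cV[R]_d :=
  \col_i Num.max (x i 0) 0.

(* [layers R m n] is the union, over all L >= 1 and all (l_0, ..., l_L) with
   l_0 = m, l_L = n and l_1, ..., l_(L-1) positive, of the products
   prod_(1 <= k <= L) (R^(l_k x l_(k-1)) x R^(l_k)).  The list is headed by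
   (W_1, B_1); [OutLayer] holds the last pair (W_L, B_L). *)
Inductive layers (R : realType) : nat -> nat -> Type :=
| OutLayer (m n : nat) (W : 'M[R]_(n, m)) (B : 'cV[R]_n) : layers R m n
| HidLayer (m p n : nat) (W : 'M[R]_(p, m)) (B : 'cV[R]_p) (p_gt0 : (0 < p)%N)
    (s : layers R p n) : layers R m n.

Fixpoint layers_fun (R : realType) (m n : nat) (s : layers R m n) :
    'cV[R]_m -> 'cV[R]_n :=
  match s in layers _ m n return 'cV[R]_m -> 'cV[R]_n with
  | OutLayer _ _ W B => fun x => W *m x + B
  | HidLayer _ _ _ W B _ s' => fun x => layers_fun s' (relu (W *m x + B))
  end.

Fixpoint layers_size (R : realType) (m n : nat) (s : layers R m n) : nat :=
  match s with
  | OutLayer m n _ _ => (n * (m + 1))%N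
  | HidLayer m p _ _ _ _ s' => (p * (m + 1) + layers_size s')%N
  end.

(* The set bold-N. *)
Record network (R : realType) : Type := Network {
  dim_in : nat;
  dim_out : nat;
  dim_in_gt0 : (0 < dim_in)%N;
  dim_out_gt0 : (0 < dim_out)%N;
  net_layers : layers R dim_in dim_out }.

(* The union over k, l of the sets of functions from R^k to R^l. *)
Record euclid_map (R : realType) : Type := EuclidMap {
  map_dom : nat;
  map_cod : nat;
  map_fun : 'cV[R]_map_dom -> 'cV[R]_map_cod }.

(* F belongs to C(R^k, R^l). *)
Definition in_C (R : realType) (k l : nat) (F : euclid_map R) : Prop :=
  [/\ map_dom F = k, map_cod F = l & continuous (@map_fun R F)].

(* The value F(x) in R^l for F : R^k -> R^l; [conform_mx 0] is the identity when
   the dimensions agree, so this is meaningful exactly when F has domain R^k and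
   codomain R^l, which [in_C k l F] guarantees. *)
Definition map_at (R : realType) (k l : nat) (F : euclid_map R) (x : 'cV[R]_k) :
    'cV[R]_l :=
  conform_mx 0 (map_fun (conform_mx (0 : 'cV[R]_(map_dom F)) x)).

Definition realization (R : realType) (Phi : network R) : euclid_map R :=
  EuclidMap (layers_fun (net_layers Phi)).

Definition num_params (R : realType) (Phi : network R) : nat :=
  layers_size (net_layers Phi).

Definition time_space (R : realType) (d : nat) (t : R) (x : 'cV[R]_d) :
    'cV[R]_d.+1 :=
  col_mx (t%:M : 'cV[R]_1) x.

(* Main.v *)
Require Import Defs.
From mathcomp Require Import all_boot all_order all_algebra.
From mathcomp Require Import all_classical all_reals all_analysis.
From mathcomp Require Import ring lra zify.
Import Order.TTheory GRing.Theory Num.Theory.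
Import numFieldNormedType.Exports.
Local Open Scope ring_scope.

(* With h = T/N and r_n the ramp that climbs from 0 to 1 on [nh, (n+1)h], the
   Euler interpolation is
     Y_t = x + sum_(n < N) h r_n(t) f(y_n),
   where the grid points y_n do not depend on t and are computed exactly by
   iterating the given network for f.  Only the N products r_n(t) * f(y_n) have
   to be approximated, for all d coordinates in parallel.  A product of
   s in [0, 1] with a real v is obtained by clipping v/2^m to [-1, 1],
   polarization, and Yarotsky's approximation of the square by m iterates of the
   tooth function; its error is at most 2^-m (1 + |v|^3), and m of order
   |ln eps| gives 2^-m <= eps. *)

(** * Affine maps *)

Section Networks.
#[local] Set Implicit Arguments.
#[local] Unset Strict Implicit.
Variable R : realType.

Definition affine (m n : nat) (f : 'cV[R]_m -> 'cV[R]_n) : Prop :=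
  exists (W : 'M[R]_(n, m)) (B : 'cV[R]_n), forall x, f x = W *m x + B.

Lemma affine_id m : affine (fun x : 'cV[R]_m => x).
Proof. by exists 1%:M, 0 => x; rewrite mul1mx addr0. Qed.

Lemma affine_cst m n (B : 'cV[R]_n) : affine (fun _ : 'cV[R]_m => B).
Proof. by exists 0, B => x; rewrite mul0mx add0r. Qed.

Lemma affineD m n (f g : 'cV[R]_m -> 'cV[R]_n) :
  affine f -> affine g -> affine (fun x => f x + g x).
Proof.
move=> [W [B fE]] [V [C gE]]; exists (W + V), (B + C) => x.
by rewrite fE gE mulmxDl addrACA.
Qed.

Lemma affineZ m n (a : R) (f : 'cV[R]_m -> 'cV[R]_n) :
  affine f -> affine (fun x => a *: f x).
Proof.
move=> [W [B fE]]; exists (a *: W), (a *: B) => x.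
by rewrite fE scalerDr scalemxAl.
Qed.

Lemma affineB m n (f g : 'cV[R]_m -> 'cV[R]_n) :
  affine f -> affine g -> affine (fun x => f x - g x).
Proof.
move=> af /(affineZ (-1)) ag; have [W [B E]] := affineD af ag.
by exists W, B => x; rewrite -E scaleN1r.
Qed.

Lemma affine_col m n p (f : 'cV[R]_m -> 'cV[R]_n) (g : 'cV[R]_m -> 'cV[R]_p) :
  affine f -> affine g -> affine (fun x => col_mx (f x) (g x)).
Proof.
move=> [W [B fE]] [V [C gE]]; exists (col_mx W V), (col_mx B C) => x.
by rewrite fE gE mul_col_mx add_col_mx.
Qed.

Lemma affine_usub m n p (f : 'cV[R]_m -> 'cV[R]_(n + p)) :
  affine f -> affine (fun x => usubmx (f x)).
Proof.
move=> [W [B fE]]; exists (usubmx W), (usubmx B) => x.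
by rewrite fE linearD /= mul_usub_mx.
Qed.

Lemma affine_dsub m n p (f : 'cV[R]_m -> 'cV[R]_(n + p)) :
  affine f -> affine (fun x => dsubmx (f x)).
Proof.
move=> [W [B fE]]; exists (dsubmx W), (dsubmx B) => x.
by rewrite fE linearD /= mul_dsub_mx.
Qed.

(** Used to copy the single time value into all [d] coordinates, so that [d] products with the same
    ramp run in parallel. *)
Lemma affine_rep m n (f : 'cV[R]_m -> 'cV[R]_1) :
  affine f -> affine (fun x => const_mx (f x 0 0) : 'cV[R]_n).
Proof.
move=> [W [B fE]].
exists (\matrix_(i, j) W 0 j), (const_mx (B 0 0)) => x.
apply/colP => i; rewrite fE !mxE; congr (_ + _).
by apply: eq_bigr => j _; rewrite mxE.
Qed.

(** * Depth, width, parameter count and composition of networks *)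

Fixpoint hidden_depth m n (s : layers R m n) : nat :=
  if s is HidLayer _ _ _ _ _ _ s' then (hidden_depth s').+1 else 0%N.

Fixpoint hidden_width m n (s : layers R m n) : nat :=
  if s is HidLayer _ p _ _ _ _ s' then maxn p (hidden_width s') else 0%N.

(* Only hidden layers count for the width [w] and depth [k], so that composition
   adds depths and affine maps cost nothing. *)
Definition nn (w k m n : nat) (f : 'cV[R]_m -> 'cV[R]_n) : Prop :=
  exists s : layers R m n,
    [/\ forall x, layers_fun s x = f x, (hidden_depth s <= k)%N
      & (hidden_width s <= w)%N].

(** There is one more affine map than there are hidden layers, and each has at most [w] rows of
    [w + 1] parameters. *)
Lemma layers_size_le m n (s : layers R m n) w :
    (m <= w)%N -> (n <= w)%N -> (hidden_width s <= w)%N ->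
  (layers_size s <= (hidden_depth s).+1 * (w * w.+1))%N.
Proof.
elim: s => {m n} [m n W B | m p n W B p_gt0 s IH] mw nw /=.
  by move=> _; rewrite mul1n addn1 leq_mul.
rewrite geq_max => /andP[pw sw].
by rewrite mulSn leq_add ?IH // addn1 leq_mul.
Qed.

(** Each layer owns at least one parameter. Together with the next two lemmas this turns the
    parameter count of a given network into bounds on its depth, width and output dimension. *)
Lemma hidden_depth_le m n (s : layers R m n) :
  (0 < n)%N -> (hidden_depth s < layers_size s)%N.
Proof.
elim: s => {m n} [m n W B | m p n W B p_gt0 s IH] n_gt0 /=; first by nia.
by have := IH n_gt0; nia.
Qed.

Lemma hidden_width_le m n (s : layers R m n) :
  (hidden_width s <= layers_size s)%N.
Proof.
elim: s => {m n} [m n W B | m p n W B p_gt0 s IH] //=.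
by rewrite geq_max; nia.
Qed.

Lemma dim_out_le m n (s : layers R m n) : (n <= layers_size s)%N.
Proof. by elim: s => {m n} [m n W B | m p n W B p_gt0 s IH] /=; nia. Qed.

Lemma nn_eq w k m n (f g : 'cV[R]_m -> 'cV[R]_n) :
  f =1 g -> nn w k f -> nn w k g.
Proof. by move=> fg [s [sf sk sw]]; exists s; split=> // x; rewrite sf. Qed.

Lemma nn_le w w' k k' m n (f : 'cV[R]_m -> 'cV[R]_n) :
  (w <= w')%N -> (k <= k')%N -> nn w k f -> nn w' k' f.
Proof.
move=> ww kk [s [sf sk sw]]; exists s; split=> //.
  exact: leq_trans kk.
exact: leq_trans ww.
Qed.

Lemma nn_affine m n (f : 'cV[R]_m -> 'cV[R]_n) : affine f -> nn 0 0 f.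
Proof. by move=> [W [B fE]]; exists (OutLayer W B); split=> // x; rewrite fE. Qed.

(** The identity W (V x + C) + B = (W V) x + (W C + B) merges the affine map into the first layer,
    be it hidden or the output layer. *)
Lemma nn_precomp w k m n p (f : 'cV[R]_m -> 'cV[R]_n) (g : 'cV[R]_n -> 'cV[R]_p) :
  affine f -> nn w k g -> nn w k (fun x => g (f x)).
Proof.
move=> [V [C fE]] [s [sf sk sw]].
suff [s' [s'E dE wE]] : exists s' : layers R m p,
    [/\ forall x, layers_fun s' x = layers_fun s (V *m x + C),
      hidden_depth s' = hidden_depth s & hidden_width s' = hidden_width s].
  by exists s'; rewrite dE wE; split=> // x; rewrite s'E sf fE.
move: V C {f g fE sf sk sw}; case: s => {n p} [n p W B | n q p W B q_gt0 s] V C.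
  exists (OutLayer (W *m V) (W *m C + B)); split=> //= x.
  by rewrite mulmxDr mulmxA addrA.
exists (HidLayer (W *m V) (W *m C + B) q_gt0 s); split=> //= x.
by rewrite mulmxDr mulmxA addrA.
Qed.

Lemma nn_relu w k m n p (f : 'cV[R]_m -> 'cV[R]_n) (g : 'cV[R]_n -> 'cV[R]_p) :
    (0 < n)%N -> (n <= w)%N -> affine f -> nn w k g ->
  nn w k.+1 (fun x => g (relu (f x))).
Proof.
move=> n_gt0 nw [V [C fE]] [s [sf sk sw]].
exists (HidLayer V C n_gt0 s); split=> //= [x|]; first by rewrite sf fE.
by rewrite geq_max nw.
Qed.

Lemma nn_relu1 w m n p (f : 'cV[R]_m -> 'cV[R]_n) (g : 'cV[R]_n -> 'cV[R]_p) :
    (0 < n)%N -> (n <= w)%N -> affine f -> affine g ->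
  nn w 1 (fun x => g (relu (f x))).
Proof.
by move=> n0 nw af /nn_affine ag; apply: nn_relu => //; apply: nn_le ag.
Qed.

Lemma nn_comp w k l m n p (f : 'cV[R]_m -> 'cV[R]_n) (g : 'cV[R]_n -> 'cV[R]_p) :
  nn w k f -> nn w l g -> nn w (k + l) (fun x => g (f x)).
Proof.
move=> [s [sf sk sw]] ng; suff: nn w (hidden_depth s + l) (fun x => g (layers_fun s x)).
  move=> h; apply: nn_eq (nn_le (leqnn w) _ h) => [x|]; first by rewrite sf.
  by rewrite leq_add2r.
elim: s g ng sw {f sf sk} => {m n} [m n W B | m q n W B q_gt0 s IH] g ng /=.
  by move=> _; apply: nn_precomp => //; exists W, B.
rewrite geq_max => /andP[qw sw].
apply: (nn_relu (g := fun y => g (layers_fun s y))) => //; last exact: IH.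
by exists W, B.
Qed.

Lemma relu_col m n (x : 'cV[R]_m) (y : 'cV[R]_n) :
  relu (col_mx x y) = col_mx (relu x) (relu y).
Proof. by apply/colP => i; rewrite !mxE; case: splitP => j _; rewrite mxE. Qed.

Lemma relu_subK m (x : 'cV[R]_m) : relu x - relu (- x) = x.
Proof.
apply/colP => i; rewrite !mxE /Num.max; case: ltrP => ?; case: ltrP => ?; lra.
Qed.

(* The extra inputs pass through hidden layers as relu(y) - relu(-y), whence the
   width 2q. *)
Lemma nn_carry q w k m n (f : 'cV[R]_m -> 'cV[R]_n) : nn w k f ->
  nn (w + q + q) k
    (fun z : 'cV[R]_(m + q) => col_mx (f (usubmx z)) (dsubmx z)).
Proof.
move=> [s [sf sk sw]].
suff: nn (w + q + q) (hidden_depth s)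
    (fun z : 'cV[R]_(m + q) => col_mx (layers_fun s (usubmx z)) (dsubmx z)).
  by move=> h; apply: nn_eq (nn_le (leqnn _) sk h) => z; rewrite sf.
elim: s sw {f sf sk} => {m n} [m n W B _ | m p n W B p_gt0 s IH] /=.
  apply: nn_le (nn_affine _) => //; apply: affine_col.
    have [V [C E]] := affine_usub (@affine_id (m + q)).
    exists (W *m V), (W *m C + B) => z /=.
    by rewrite E mulmxDr addrA mulmxA.
  exact/affine_dsub/affine_id.
rewrite geq_max => /andP[pw sw].
(* [h] recombines the positive and negative parts of the carried inputs; being affine, it merges
   into the next layer. *)
pose h (y : 'cV[R]_(p + q + q)) : 'cV[R]_(p + q) :=
  col_mx (usubmx (usubmx y)) (dsubmx (usubmx y) - dsubmx y).
have ah : affine h.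
  apply: affine_col; first by do 2!apply: affine_usub; exact: affine_id.
  by apply: affineB; do ?[apply: affine_dsub|apply: affine_usub]; exact: affine_id.
pose a (z : 'cV[R]_(m + q)) : 'cV[R]_(p + q + q) :=
  col_mx (col_mx (W *m usubmx z + B) (dsubmx z)) (0 - dsubmx z).
have aa : affine a.
  have ad : affine (fun z : 'cV[R]_(m + q) => dsubmx z) by exact/affine_dsub/affine_id.
  apply: affine_col; last by apply: affineB => //; exact: affine_cst.
  apply: affine_col => //.
  have [V [C E]] := affine_usub (@affine_id (m + q)).
  by exists (W *m V), (W *m C + B) => z /=; rewrite E mulmxDr addrA mulmxA.
apply: nn_eq (nn_relu _ _ aa (nn_precomp ah (IH sw))) => [z||].
- by rewrite /a /h !relu_col !col_mxKu !col_mxKd sub0r relu_subK.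
- by rewrite -addnA ltn_addr.
- by rewrite !leq_add2r.
Qed.

(** * Continuity of realizations *)

Lemma continuous_sumr (T : topologicalType) (I : Type) (r : seq I)
    (f : I -> T -> R) :
  (forall i, continuous (f i)) -> continuous (fun y => \sum_(i <- r) f i y).
Proof.
move=> fc; elim: r => [|i r IH].
  by under eq_fun do rewrite big_nil; exact: cst_continuous.
under eq_fun do rewrite big_cons.
by move=> x; apply: continuousD; [exact: fc|exact: IH].
Qed.

(** A basic neighbourhood of a matrix prescribes one neighbourhood per entry, and finitely many
    conditions that hold nearby hold jointly. *)
Lemma continuous_coordP m n (f : 'cV[R]_m -> 'cV[R]_n) :
  (forall i, continuous (fun x => f x i 0)) -> continuous f.
Proof.
move=> fc x A [P Pn PA].
have : \forall y \near x, forall i : 'I_n, P i 0 (f y i 0).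
  apply: (@filter_forall _ _ (fun i y => P i 0 (f y i 0)) (nbhs x)) => i.
  exact: (fc i x (P i 0) (Pn i 0)).
by apply: filterS => y Py; apply: PA => i j; rewrite (ord1 j).
Qed.

Lemma continuous_mulmxD m n (W : 'M[R]_(n, m)) (B : 'cV[R]_n) :
  continuous (fun x : 'cV[R]_m => W *m x + B).
Proof.
apply: continuous_coordP => i x.
under eq_fun do rewrite !mxE.
apply: (@continuousD _ _ _ (fun x : 'cV[R]_m => \sum_j W i j * x j 0)
  (fun=> B i 0)); last exact: cst_continuous.
apply: continuous_sumr => j y.
apply: (@continuousM _ _ (fun=> W i j) (fun x : 'cV[R]_m => x j 0)).
  exact: cst_continuous.
exact: coord_continuous.
Qed.

Lemma continuous_relu m : continuous (@relu R m).
Proof.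
apply: continuous_coordP => i x.
under eq_fun do rewrite !mxE.
apply: (@continuous_max _ _ (fun x : 'cV[R]_m => x i 0) (fun=> 0)).
  exact: coord_continuous.
exact: cst_continuous.
Qed.

Lemma continuous_layers_fun m n (s : layers R m n) : continuous (layers_fun s).
Proof.
elim: s => {m n} [m n W B | m p n W B p_gt0 s IH] /=.
  exact: continuous_mulmxD.
move=> x; apply: (@continuous_comp _ _ _ (fun x => relu (W *m x + B))); last exact: IH.
apply: continuous_comp; first exact: continuous_mulmxD.
exact: continuous_relu.
Qed.

End Networks.

(** * Approximation of squares and products of reals *)

Section ScalarProduct.
#[local] Set Implicit Arguments.
#[local] Unset Strict Implicit.
Variable R : realType.
Implicit Types (s v w x : R) (m : nat).

Definition tooth x : R := 2 * Num.max x 0 - 4 * Num.max (x - 1 / 2) 0.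

(* With p(x) = x (1 - x) this is p = (tooth + p o tooth) / 4, whose iteration
   yields the series for p behind [sqa]. *)
Lemma toothE x : 0 <= x <= 1 ->
  0 <= tooth x <= 1 /\
  x * (1 - x) = (tooth x + tooth x * (1 - tooth x)) / 4.
Proof.
move=> /andP[x0 x1]; rewrite /tooth /Num.max.
case: ltrP => ?; case: ltrP => ?; split; first [lra | nra | field].
Qed.

(** On [0, 1] this is the piecewise linear interpolant of the square at the multiples of 2^-m. *)
Fixpoint sqa m x : R :=
  if m is m'.+1 then sqa m' x - iter m tooth x / 4 ^+ m else x.

(** By induction: [toothE] at the current iterate splits the remainder into the next term of the sum
    and the next remainder. *)
Lemma sqaE m x : 0 <= x <= 1 ->
  0 <= iter m tooth x <= 1 /\
  sqa m x = x ^+ 2 + iter m tooth x * (1 - iter m tooth x) / 4 ^+ m.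
Proof.
move=> x01; elim: m => [|m [y01 sE]].
  by split => //=; rewrite expr0 divr1; ring.
have [t01 tE] := toothE y01; split => //=.
rewrite sE /= tE (exprS 4 m); field.
by rewrite expf_neq0.
Qed.

(** The remainder in [sqaE] is y (1 - y) / 4^m with y in [0, 1]. That it has a sign is exploited in
    [mul_unit_bound]. *)
Lemma sqa_bound m x : 0 <= x <= 1 -> 0 <= sqa m x - x ^+ 2 <= 4^-1 ^+ m.
Proof.
move=> /(sqaE m)[]; set y := iter _ _ _ => /andP[y0 y1 ->].
rewrite addrC addKr exprVn; have : 0 < (4 : R) ^- m by rewrite invr_gt0 exprn_gt0.
have yy : 0 <= y * (1 - y) <= 1 by apply/andP; split; nra.
by move: (4 ^- m) (y * (1 - y)) yy => z u /andP[u0 u1] z0; apply/andP; split; nra.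
Qed.

(** Written with positive parts so that one hidden layer computes it; [clipE] gives the usual
    form. *)
Definition clip x : R := Num.max (x + 1) 0 - Num.max (x - 1) 0 - 1.

Lemma clipE x : clip x = if x < -1 then -1 else if x <= 1 then x else 1.
Proof.
rewrite /clip /Num.max.
by case: (ltrP x (-1)) => ?; case: (lerP x 1) => ?; case: ltrP => ?; case: ltrP => ?; lra.
Qed.

(* Polarization: s w = ((s + w) / 2)^2 - ((s - w) / 2)^2. *)
Definition mul_unit m s w : R :=
  sqa m `|(s + w) / 2| - sqa m `|(s - w) / 2|.

(** Both squares are overestimated by an amount in [0, 4^-m], so the difference of the two errors is
    at most 4^-m without a factor 2. *)
Lemma mul_unit_bound m s w : 0 <= s <= 1 -> `|w| <= 1 ->
  `|mul_unit m s w - s * w| <= 4^-1 ^+ m.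
Proof.
move=> s01; rewrite ler_norml => w01.
have a01 : 0 <= `|(s + w) / 2| <= 1.
  by rewrite normr_ge0 /= ler_norml; lra.
have b01 : 0 <= `|(s - w) / 2| <= 1.
  by rewrite normr_ge0 /= ler_norml; lra.
have := sqa_bound m a01; have := sqa_bound m b01; rewrite /mul_unit.
set A := sqa m `|(s + w) / 2|; set B := sqa m `|(s - w) / 2|; rewrite !real_normK ?num_real // ler_norml.
move: A B (4^-1 ^+ m) => A B z h1 h2.
have -> : A - B - s * w =
  (A - ((s + w) / 2) ^+ 2) - (B - ((s - w) / 2) ^+ 2) by field.
lra.
Qed.

(** The scale 2^m balances two errors: it inflates the polarization error 4^-m to 2^-m, and clipping
    acts only when |v| > 2^m. *)
Definition mul_net m s v : R := 2 ^+ m * mul_unit m s (clip (v / 2 ^+ m)).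

(** The error is that of polarization, at most 1/M, plus that of clipping. The size bound uses M |w|
    <= |v| for the clipped value w and 1/M <= 1. *)
Lemma mul_net_bound m s v : 0 <= s <= 1 ->
  `|mul_net m s v - s * v| <= 2^-1 ^+ m * (1 + `|v| ^+ 3) /\
  `|mul_net m s v| <= 1 + `|v|.
Proof.
move=> s01; rewrite /mul_net; set M : R := 2 ^+ m.
have M1 : 1 <= M by rewrite exprn_ege1 // ler1n.
have M0 : 0 < M by lra.
have w1 : `|clip (v / M)| <= 1.
  rewrite clipE ler_norml; do ?case: ifP; move=> *; lra.
have wv : `|clip (v / M)| <= `|v| / M.
  have -> : `|v| / M = `|v / M| by rewrite normrM (gtr0_norm (x := M^-1)) ?invr_gt0.
  rewrite clipE; case: ltrP => h1.
    by rewrite normrN1 ltr0_norm; lra.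
  by case: (lerP (v / M) 1) => // h2; rewrite normr1 gtr0_norm; lra.
have := mul_unit_bound m s01 w1.
have -> : (4 : R)^-1 ^+ m = M^-1 ^+ 2.
  by rewrite [in RHS]exprVn exprVn /M -exprM mulnC exprM; congr (_ ^+ _)^-1; ring.
have -> : (2 : R)^-1 ^+ m = M^-1 by rewrite exprVn.
set w := clip _ in w1 wv *; move=> err.
have err' : `|M * mul_unit m s w - s * (M * w)| <= M^-1.
  have -> : M * mul_unit m s w - s * (M * w) = M * (mul_unit m s w - s * w) by ring.
  rewrite normrM (gtr0_norm M0).
  have -> : M^-1 = M * M^-1 ^+ 2 by field; lra.
  by rewrite ler_pM2l.
have Mi : 0 < M^-1 <= 1 by rewrite invr_gt0 M0 /= invf_le1.
have nv := normr_ge0 v.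
split.
  have -> : M * mul_unit m s w - s * v =
    (M * mul_unit m s w - s * (M * w)) + s * (M * w - v) by ring.
  rewrite (le_trans (ler_normD _ _)) // [leRHS]mulrDr mulr1 lerD //.
  rewrite normrM ger0_norm; last by lra.
  apply: (@le_trans _ _ `|M * w - v|).
    by rewrite ler_piMl //; lra.
  (* For |v| <= M the clipping does nothing. *)
  have [vM|Mv] := lerP `|v| M.
    suff -> : M * w = v.
      by rewrite subrr normr0 mulr_ge0 ?exprn_ge0 //; lra.
    have : `|v / M| <= 1 by rewrite normrM (gtr0_norm (x := M^-1)) ?ler_pdivrMr //; lra.
    rewrite ler_norml => /andP[h1 h2].
    by rewrite /w clipE h2 ltNge h1 /=; field; lra.
  (* Now [w] is the sign of [v], so the clipping error is |v| - M <= |v|; as M <= |v|^2, this is at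
     most |v|^3 / M. *)
  apply: (@le_trans _ _ `|v|); last first.
    have : M * 1 <= `|v| ^+ 2 by nra.
    rewrite mulr1 => h.
    have h' : 1 <= M^-1 * `|v| ^+ 2 by rewrite mulrC ler_pdivlMr // mul1r.
    by rewrite exprS mulrCA ler_peMr.
  have [v0|v0] := lerP 0 v.
    have -> : w = 1.
      rewrite /w clipE; have : 1 < v / M.
        by rewrite ltr_pdivlMr // mul1r -(ger0_norm v0).
      by move=> h; case: ltrP => ?; [lra|case: lerP => ?; lra].
    by move: Mv; rewrite (ger0_norm v0) ler_norml; lra.
  have -> : w = -1.
    rewrite /w clipE; have : v / M < -1.
      by rewrite ltr_pdivrMr //; move: Mv; rewrite ltr0_norm //; lra.
    by move=> ->.
  by move: Mv; rewrite (ltr0_norm v0) ler_norml; lra.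
have -> : M * mul_unit m s w =
  (M * mul_unit m s w - s * (M * w)) + s * (M * w) by ring.
rewrite (le_trans (ler_normD _ _)) // lerD //; first by lra.
rewrite !normrM (gtr0_norm M0) ger0_norm; last by lra.
apply: (@le_trans _ _ (M * `|w|)).
  by rewrite ler_piMl ?mulr_ge0 //; lra.
by rewrite mulrC -ler_pdivlMr.
Qed.

End ScalarProduct.

(** * The Euclidean norm *)

Section EuclideanNorm.
#[local] Set Implicit Arguments.
#[local] Unset Strict Implicit.
Variables (R : realType) (d : nat).
Implicit Types x y : 'cV[R]_d.

Lemma enorm_ge0 x : 0 <= enorm x. Proof. exact: sqrtr_ge0. Qed.

Lemma enorm_sq x : enorm x ^+ 2 = \sum_(i < d) x i 0 ^+ 2.
Proof. by rewrite sqr_sqrtr // sumr_ge0 // => i _; exact: sqr_ge0. Qed.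

Lemma coord_le_enorm x i : `|x i 0| <= enorm x.
Proof.
rewrite -sqrtr_sqr ler_wsqrtr // (bigD1 i) //= lerDl sumr_ge0 // => j _.
exact: sqr_ge0.
Qed.

(** The source of the factor d^(1/2) in the error and growth bounds. *)
Lemma enorm_le_coord x (a : R) :
  (forall i, `|x i 0| <= a) -> enorm x <= Num.sqrt d%:R * a.
Proof.
(* In dimension 0 there is no coordinate from which to derive 0 <= a. *)
case: d x => [|n] x xa; first by rewrite /enorm big_ord0 sqrtr0 mul0r.
have a0 : 0 <= a by exact: le_trans (xa ord0).
rewrite -{1}(ger0_norm a0) -sqrtr_sqr -sqrtrM ?ler0n // ler_wsqrtr //.
rewrite mulr_natl -[leRHS](_ : \sum_(i < n.+1) a ^+ 2 = _); last first.
  by rewrite sumr_const card_ord.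
apply: ler_sum => i _.
by rewrite -[leLHS]real_normK ?num_real // lerXn2r ?nnegrE.
Qed.

Lemma enormZ (a : R) x : enorm (a *: x) = `|a| * enorm x.
Proof.
rewrite /enorm -sqrtr_sqr -sqrtrM ?sqr_ge0 // mulr_sumr; congr Num.sqrt.
by apply: eq_bigr => i _; rewrite mxE exprMn.
Qed.

Lemma enorm0 : enorm (0 : 'cV[R]_d) = 0.
Proof. by rewrite -(scale0r 0) enormZ normr0 mul0r. Qed.

(** Expanding the sum of the squares (Y x_i - X y_i)^2 >= 0, with X and Y the two norms, gives 2 X Y
    (X Y - S) >= 0. If X Y = 0, one vector vanishes. *)
Lemma cauchy_schwarz x y : \sum_(i < d) x i 0 * y i 0 <= enorm x * enorm y.
Proof.
set X := enorm x; set Y := enorm y; set S := \sum_(i < d) _.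
have X0 : 0 <= X by exact: enorm_ge0.
have Y0 : 0 <= Y by exact: enorm_ge0.
have : 0 <= \sum_(i < d) (Y * x i 0 - X * y i 0) ^+ 2.
  by apply: sumr_ge0 => i _; exact: sqr_ge0.
have -> : \sum_(i < d) (Y * x i 0 - X * y i 0) ^+ 2 =
    2 * (X * Y) * (X * Y - S).
  transitivity (Y ^+ 2 * (\sum_(i < d) x i 0 ^+ 2) +
      X ^+ 2 * (\sum_(i < d) y i 0 ^+ 2) - 2 * (X * Y) * S); last first.
    by rewrite -!enorm_sq -/X -/Y; ring.
  rewrite !mulr_sumr -big_split /= -sumrB; apply: eq_bigr => i _; ring.
have [XY0|] := ltP 0 (X * Y).
  by rewrite pmulr_rge0 ?subr_ge0 //; lra.
move=> XY _; have {XY} : X * Y = 0 by apply/eqP; rewrite eq_le XY mulr_ge0.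
move=> XY; rewrite XY; move/eqP: XY; rewrite mulf_eq0 => XY.
rewrite /S big1 // => i _; apply/eqP; rewrite mulf_eq0.
have := coord_le_enorm x i; have := coord_le_enorm y i; rewrite -/X -/Y.
by case/orP: XY => /eqP ->; rewrite !normr_le0 => yi xi; apply/orP; [left|right].
Qed.

Lemma enormD x y : enorm (x + y) <= enorm x + enorm y.
Proof.
rewrite -(ler_pXn2r (n := 2)) ?nnegrE ?addr_ge0 ?enorm_ge0 //.
rewrite sqrrD !enorm_sq.
have -> : \sum_(i < d) (x + y) i 0 ^+ 2 = \sum_(i < d) x i 0 ^+ 2 +
    (\sum_(i < d) x i 0 * y i 0) *+ 2 + \sum_(i < d) y i 0 ^+ 2.
  rewrite -sumrMnl -!big_split /=; apply: eq_bigr => i _.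
  by rewrite mxE sqrrD.
by rewrite lerD2r lerD2l lerMn2r cauchy_schwarz orbT.
Qed.

Lemma enorm_sum n (F : nat -> 'cV[R]_d) (a : R) :
    (forall i, (i < n)%N -> enorm (F i) <= a) ->
  enorm (\sum_(i < n) F i) <= n%:R * a.
Proof.
elim: n => [|n IH] Fa; first by rewrite big_ord0 enorm0 mul0r.
rewrite big_ord_recr /= (le_trans (enormD _ _)) // -natr1 mulrDl mul1r.
by rewrite lerD ?Fa // IH // => i /ltnW; exact: Fa.
Qed.

End EuclideanNorm.

(** * Networks for squares, products and the Euler scheme *)

Section EulerNetwork.
#[local] Set Implicit Arguments.
#[local] Unset Strict Implicit.
Variable R : realType.
Implicit Types (w k m p d n : nat).

Lemma nn_abs p : (0 < p)%N ->
  nn (p + p) 1 (fun X : 'cV[R]_p => map_mx (fun x => `|x|) X).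
Proof.
move=> p0; pose f (X : 'cV[R]_p) := col_mx X (0 - X).
pose g (y : 'cV[R]_(p + p)) := usubmx y + dsubmx y.
have af : affine f.
  apply: affine_col; first exact: affine_id.
  by apply: affineB; [exact: affine_cst|exact: affine_id].
have ag : affine g.
  by apply: affineD; [apply: affine_usub|apply: affine_dsub]; exact: affine_id.
apply: nn_eq (nn_relu1 _ (leqnn _) af ag) => [X|]; last by rewrite addn_gt0 p0.
rewrite /g /f relu_col col_mxKu col_mxKd; apply/colP => i; rewrite !mxE sub0r.
by rewrite /Num.max; case: ltrP => ?; case: ltrP => ?;
  case: (ger0P (X i 0)) => ?; lra.
Qed.

Lemma nn_tooth p : (0 < p)%N ->
  nn (p + p) 1 (fun X : 'cV[R]_p => map_mx (@tooth R) X).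
Proof.
move=> p0; pose f (X : 'cV[R]_p) := col_mx X (X - const_mx (1 / 2)).
pose g (y : 'cV[R]_(p + p)) := 2 *: usubmx y - 4 *: dsubmx y.
have af : affine f.
  apply: affine_col; first exact: affine_id.
  by apply: affineB; [exact: affine_id|exact: affine_cst].
have ag : affine g.
  by apply: affineB; apply: affineZ; [apply: affine_usub|apply: affine_dsub];
    exact: affine_id.
apply: nn_eq (nn_relu1 _ (leqnn _) af ag) => [X|]; last by rewrite addn_gt0 p0.
by rewrite /g /f relu_col col_mxKu col_mxKd; apply/colP => i; rewrite !mxE.
Qed.

(** The state is the tooth iterate and the partial sum. Each step costs one hidden layer: 2p neurons
    for the tooth and 2p to carry the sum, which is then updated affinely. *)
Lemma nn_sqa_state p m : (0 < p)%N ->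
  nn (p + p + p + p) m (fun X : 'cV[R]_p =>
    col_mx (map_mx (iter m (@tooth R)) X) (map_mx (sqa m) X)).
Proof.
move=> p0; elim: m => [|m IH].
  apply: nn_le (nn_affine _) => //.
  by apply: affine_col; have [W [B E]] := @affine_id R p;
    exists W, B => X; rewrite -E; apply/colP => i; rewrite mxE.
pose g (y : 'cV[R]_(p + p)) :=
  col_mx (usubmx y) (dsubmx y - (4 ^+ m.+1)^-1 *: usubmx y).
have ag : affine g.
  have au : affine (fun y : 'cV[R]_(p + p) => usubmx y) by exact/affine_usub/affine_id.
  apply: affine_col => //; apply: affineB; last exact: affineZ.
  exact/affine_dsub/affine_id.
have nT := nn_comp (nn_carry p (nn_tooth p0)) (nn_le (leq0n _) (leqnn _) (nn_affine ag)).
apply: nn_eq (nn_le (leqnn _) _ (nn_comp IH nT)) => [X|]; last by rewrite addn0 addn1.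
rewrite /g !col_mxKu !col_mxKd; congr col_mx; apply/colP => i; rewrite !mxE //=.
by rewrite mulrC.
Qed.

Lemma nn_sqa p m : (0 < p)%N ->
  nn (p + p + p + p) m (fun X : 'cV[R]_p => map_mx (sqa m) X).
Proof.
move=> p0.
have ad : affine (fun y : 'cV[R]_(p + p) => dsubmx y) by exact/affine_dsub/affine_id.
have := nn_comp (nn_sqa_state m p0) (nn_le (leq0n _) (leqnn _) (nn_affine ad)).
by rewrite addn0; apply: nn_eq => X; rewrite col_mxKd.
Qed.

(** For h > 0, h times the ramp is the length of the part of [a, a + h] before t. *)
Definition ramp (a h t : R) : R := (Num.max (t - a) 0 - Num.max (t - a - h) 0) / h.

Definition mul_vec d m (s : R) (v : 'cV[R]_d) : 'cV[R]_d := map_mx (mul_net m s) v.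

(** One hidden layer computes clip and ramp, one the absolute values, and [m] the squares. The
    latter act on 2d numbers at 4 neurons each, whence the width 8d. *)
Lemma nn_mul d m (a h : R) : (0 < d)%N ->
  nn (8 * d) (m + 2) (fun z : 'cV[R]_(d + 1) =>
    mul_vec m (ramp a h (dsubmx z 0 0)) (usubmx z)).
Proof.
move=> d0; set M : R := 2 ^+ m.
(* The arguments of the four positive parts that make up clip and ramp. *)
pose f (z : 'cV[R]_(d + 1)) : 'cV[R]_(d + d + (d + d)) :=
  col_mx (col_mx (M^-1 *: usubmx z + const_mx 1) (M^-1 *: usubmx z - const_mx 1))
    (col_mx (const_mx (dsubmx z 0 0) - const_mx a)
            (const_mx (dsubmx z 0 0) - const_mx (a + h))).
have af : affine f.
  have au : affine (fun z : 'cV[R]_(d + 1) => M^-1 *: usubmx z).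
    exact/affineZ/affine_usub/affine_id.
  have ad : affine (fun z : 'cV[R]_(d + 1) => const_mx (dsubmx z 0 0) : 'cV[R]_d).
    exact/affine_rep/affine_dsub/affine_id.
  have ac (B : 'cV[R]_d) : affine (fun _ : 'cV[R]_(d + 1) => B) by exact: affine_cst.
  apply: affine_col; apply: affine_col;
    [exact: affineD|exact: affineB|exact: affineB|exact: affineB].
(* Assembles ramp and clip into the half sum and half difference of the polarization. *)
pose g (y : 'cV[R]_(d + d + (d + d))) : 'cV[R]_(d + d) :=
  let s := h^-1 *: (usubmx (dsubmx y) - dsubmx (dsubmx y)) in
  let x := usubmx (usubmx y) - dsubmx (usubmx y) - const_mx 1 in
  col_mx (2^-1 *: (s + x)) (2^-1 *: (s - x)).
have ag : affine g.
  have a1 : affine (fun y : 'cV[R]_(d + d + (d + d)) =>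
      h^-1 *: (usubmx (dsubmx y) - dsubmx (dsubmx y))).
    apply: affineZ; apply: affineB; [apply/affine_usub|apply/affine_dsub];
      exact/affine_dsub/affine_id.
  have a2 : affine (fun y : 'cV[R]_(d + d + (d + d)) =>
      usubmx (usubmx y) - dsubmx (usubmx y) - const_mx 1).
    apply: affineB; last exact: affine_cst.
    by apply: affineB; [apply/affine_usub|apply/affine_dsub];
      exact/affine_usub/affine_id.
  by apply: affine_col; apply: affineZ; [apply: affineD|apply: affineB].
pose e (y : 'cV[R]_(d + d)) : 'cV[R]_d := M *: (usubmx y - dsubmx y).
have ae : affine e.
  by apply: affineZ; apply: affineB; [apply: affine_usub|apply: affine_dsub]; exact: affine_id.
have dd0 : (0 < d + d)%N by rewrite addn_gt0 d0.
have w8 : (d + d + (d + d) <= 8 * d)%N by lia.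
have n1 : nn (8 * d) 1 (fun z => g (relu (f z))).
  by apply: nn_relu1 => //; rewrite addn_gt0 dd0.
have n2 : nn (8 * d) 1 (fun X : 'cV[R]_(d + d) => map_mx (fun x => `|x|) X).
  exact: nn_le (nn_abs dd0).
have n3 : nn (8 * d) m (fun X : 'cV[R]_(d + d) => map_mx (sqa m) X).
  by apply: nn_le (nn_sqa m dd0) => //; lia.
have n4 : nn (8 * d) 0 e by exact: nn_le (nn_affine ae).
have := nn_comp (nn_comp (nn_comp n1 n2) n3) n4.
rewrite addn0 addnC; apply: nn_eq => z.
rewrite /e /g /f !relu_col !col_mxKu !col_mxKd; apply/colP => i.
rewrite !map_col_mx !col_mxKu !col_mxKd !mxE /mul_net /mul_unit /ramp /clip.
by rewrite -/M !(mulrC M^-1) !(mulrC h^-1) !(mulrC 2^-1) (opprD a) !addrA.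
Qed.

(** First f(y) is computed while the state is carried along, then the product with the ramp, which
    is finally added to the partial sum. Carrying 1 + 2d numbers costs width 4d + 2, and 8d + 4d + 2
    <= 14d. *)
Lemma nn_euler_step d w k m (f : 'cV[R]_d -> 'cV[R]_d) (a h : R) :
    (0 < d)%N -> nn w k f ->
  nn (w + 14 * d) (k + (m + 2)) (fun z : 'cV[R]_(1 + (d + d)) =>
    let y := usubmx (dsubmx z) in
    col_mx (usubmx z) (col_mx (y + h *: f y)
      (dsubmx (dsubmx z) + h *: mul_vec m (ramp a h (usubmx z 0 0)) (f y)))).
Proof.
move=> d0 nf.
pose f1 (z : 'cV[R]_(1 + (d + d))) := col_mx (usubmx (dsubmx z)) z.
have a1 : affine f1.
  apply: affine_col; last exact: affine_id.
  exact/affine_usub/affine_dsub/affine_id.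
(* The inputs of the product network come first, then the state with its grid point already
   advanced. *)
pose f2 (u : 'cV[R]_(d + (1 + (d + d)))) :=
  let v := usubmx u in let z := dsubmx u in
  col_mx (col_mx v (usubmx z))
    (col_mx (usubmx z) (col_mx (usubmx (dsubmx z) + h *: v) (dsubmx (dsubmx z)))).
have a2 : affine f2.
  have av : affine (fun u : 'cV[R]_(d + (1 + (d + d))) => usubmx u).
    exact/affine_usub/affine_id.
  have az : affine (fun u : 'cV[R]_(d + (1 + (d + d))) => dsubmx u).
    exact/affine_dsub/affine_id.
  apply: affine_col; apply: affine_col => //; first exact: affine_usub.
    exact: affine_usub.
  apply: affine_col; last exact/affine_dsub/affine_dsub.
  by apply: affineD; [exact/affine_usub/affine_dsub|exact: affineZ].
pose f3 (u : 'cV[R]_(d + (1 + (d + d)))) :=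
  let q := usubmx u in let z := dsubmx u in
  col_mx (usubmx z) (col_mx (usubmx (dsubmx z)) (dsubmx (dsubmx z) + h *: q)).
have a3 : affine f3.
  have av : affine (fun u : 'cV[R]_(d + (1 + (d + d))) => usubmx u).
    exact/affine_usub/affine_id.
  have az : affine (fun u : 'cV[R]_(d + (1 + (d + d))) => dsubmx u).
    exact/affine_dsub/affine_id.
  apply: affine_col; first exact: affine_usub.
  apply: affine_col; first exact/affine_usub/affine_dsub.
  by apply: affineD; [exact/affine_dsub/affine_dsub|exact: affineZ].
have n1 := nn_precomp a1 (nn_carry (1 + (d + d)) nf).
have n2 := nn_precomp a2 (nn_carry (1 + (d + d)) (nn_mul m a h d0)).
have {}n1 : nn (w + 14 * d) k _ := nn_le _ (leqnn _) n1.
have {}n2 : nn (w + 14 * d) (m + 2) _ := nn_le _ (leqnn _) n2.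
have n3 : nn (w + 14 * d) 0 f3 := nn_le (leq0n _) (leqnn _) (nn_affine a3).
have := nn_comp (n1 _) (nn_comp (n2 _) n3); rewrite addn0 => /(_ _ _).
have -> : (w + (1 + (d + d)) + (1 + (d + d)) <= w + 14 * d)%N by lia.
have -> : (8 * d + (1 + (d + d)) + (1 + (d + d)) <= w + 14 * d)%N by lia.
move=> /(_ isT isT); apply: nn_eq => z /=.
by rewrite /f1 /f2 /f3 !col_mxKu !col_mxKd !col_mxKu.
Qed.

Fixpoint euler d (f : 'cV[R]_d -> 'cV[R]_d) (h : R) (x : 'cV[R]_d) n : 'cV[R]_d :=
  if n is n'.+1 then euler f h x n' + h *: f (euler f h x n') else x.

Definition euler_approx d (f : 'cV[R]_d -> 'cV[R]_d) m n (h t : R) (x : 'cV[R]_d) :=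
  x + \sum_(i < n) h *: mul_vec m (ramp (i%:R * h) h t) (f (euler f h x i)).

(* The state consists of t, the current grid point, and the partial sum. *)
Lemma nn_euler_state d w k m n (f : 'cV[R]_d -> 'cV[R]_d) (h : R) :
    (0 < d)%N -> nn w k f ->
  nn (w + 14 * d) (n * (k + (m + 2))) (fun z : 'cV[R]_(1 + d) =>
    col_mx (usubmx z) (col_mx (euler f h (dsubmx z) n)
      (euler_approx f m n h (usubmx z 0 0) (dsubmx z)))).
Proof.
move=> d0 nf; elim: n => [|n IH].
  apply: nn_le (nn_affine _) => //; rewrite /euler_approx.
  have ad : affine (fun z : 'cV[R]_(1 + d) => dsubmx z) by exact/affine_dsub/affine_id.
  apply: affine_col; first exact/affine_usub/affine_id.
  apply: affine_col => //=; have [W [B E]] := ad.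
  by exists W, B => z; rewrite big_ord0 addr0 E.
rewrite (mulSn n) (addnC (k + _)%N); apply: nn_eq (nn_comp IH (nn_euler_step m (n%:R * h) h d0 nf)) => z.
rewrite /= !col_mxKu !col_mxKd col_mxKu.
by rewrite /euler_approx big_ord_recr /= addrA.
Qed.

(** With [P] bounding depth, width and dimension of the given network, the new one has depth at most
    N (P + m + 2) and width at most 15 P. *)
Lemma euler_layers d m N (s : layers R d d) (h : R) : (0 < d)%N -> (0 < N)%N ->
  exists s' : layers R d.+1 d,
    (forall t x, layers_fun s' (time_space t x) =
      euler_approx (layers_fun s) m N h t x) /\
    (layers_size s' <= 240 * N * (m + 4) * layers_size s ^ 3)%N.
Proof.
move=> d0 N0; set P := layers_size s.
have dP : (d <= P)%N by exact: dim_out_le.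
have ns : nn P P (layers_fun s).
  exists s; split=> //; last exact: hidden_width_le.
  exact/ltnW/hidden_depth_le.
have ad : affine (fun y : 'cV[R]_(1 + (d + d)) => dsubmx (dsubmx y)).
  exact/affine_dsub/affine_dsub/affine_id.
have := nn_comp (nn_euler_state m N h d0 ns) (nn_le (leq0n _) (leqnn _) (nn_affine ad)).
rewrite addn0 => -[s' [sE sk sw]]; exists s'; split=> [t x|].
  by rewrite /time_space sE /= !col_mxKd col_mxKu mxE eqxx mulr1n.
have W15 : (P + 14 * d <= 15 * P)%N by lia.
have sP := @layers_size_le _ _ _ s' (15 * P) _ _ (leq_trans sw W15).
apply: leq_trans (sP _ _) _; [lia|lia|].
(* As P >= 1, P + m + 3 <= P (m + 4). *)
have k1 : ((hidden_depth s').+1 <= N * (P * (m + 4)))%N.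
  apply: (@leq_trans (N * (P + (m + 2) + 1))); last by rewrite leq_mul2l; nia.
  by rewrite -addn1 [X in (_ <= X)%N]mulnDr muln1 leq_add.
have k2 : (15 * P * (15 * P).+1 <= 240 * P ^ 2)%N by rewrite -mulnn; nia.
apply: leq_trans (leq_mul k1 k2) _; rewrite !expnS expn0; nia.
Qed.

End EulerNetwork.

(** * Interpolation formula, growth and approximation error of the Euler scheme *)

Section EulerScheme.
#[local] Set Implicit Arguments.
#[local] Unset Strict Implicit.
Variables (R : realType) (d : nat) (f : 'cV[R]_d -> 'cV[R]_d).
Implicit Types (t a h c : R) (x : 'cV[R]_d) (n N m : nat).

Lemma ramp_itv a h t : 0 < h -> 0 <= ramp a h t <= 1.
Proof.
move=> h0; rewrite /ramp divr_ge0 ?ler_pdivrMr ?mul1r ?(ltW h0) //= /Num.max;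
  by case: ltrP => ?; case: ltrP => ?; lra.
Qed.

Lemma ramp_before a h t : 0 < h -> t <= a -> ramp a h t = 0.
Proof.
move=> h0 ta; rewrite /ramp; have -> : Num.max (t - a) 0 - Num.max (t - a - h) 0 = 0.
  by rewrite /Num.max; case: ltrP => ?; case: ltrP => ?; lra.
by rewrite mul0r.
Qed.

Lemma ramp_during a h t : 0 < h -> a <= t <= a + h -> h * ramp a h t = t - a.
Proof.
move=> h0 /andP[a1 a2]; rewrite /ramp mulrC divfK ?gt_eqF // /Num.max.
by case: ltrP => ?; case: ltrP => ?; lra.
Qed.

Lemma ramp_after a h t : 0 < h -> a + h <= t -> ramp a h t = 1.
Proof.
move=> h0 ta; rewrite /ramp; have -> : Num.max (t - a) 0 - Num.max (t - a - h) 0 = h.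
  by rewrite /Num.max; case: ltrP => ?; case: ltrP => ?; lra.
by rewrite divff ?gt_eqF.
Qed.

(** On the n-th interval the earlier ramps equal 1, the n-th contributes t - n h, and the later ones
    vanish. *)
Lemma euler_interpolation N h x (y : R -> 'cV[R]_d) : 0 < h -> y 0 = x ->
    (forall n, (n < N)%N -> forall t, n%:R * h <= t <= n.+1%:R * h ->
      y t = y (n%:R * h) + (t - n%:R * h) *: f (y (n%:R * h))) ->
  forall t, 0 <= t <= N%:R * h ->
  y t = x + \sum_(n < N) (h * ramp (n%:R * h) h t) *: f (euler f h x n).
Proof.
move=> h0 y0 yS.
have yE n : (n <= N)%N -> y (n%:R * h) = euler f h x n.
  elim: n => [|n IH] nN; first by rewrite mul0r y0.
  rewrite (yS n) //; last by rewrite lexx ler_pM2r // ler_nat leqnSn.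
  by rewrite IH ?(ltnW nN) // -mulrBl -natrB ?leqnSn // subSnn mul1r.
(* Induction on the number of intervals, since only the ramps started before t matter. *)
suff : forall n, (n <= N)%N -> forall t, 0 <= t <= n%:R * h ->
    y t = x + \sum_(i < n) (h * ramp (i%:R * h) h t) *: f (euler f h x i).
  by move/(_ N (leqnn N)).
elim=> [|n IH] nN t /andP[t0 tn].
  have -> : t = 0 by apply/eqP; rewrite eq_le t0; move: tn; rewrite mul0r => ->.
  by rewrite big_ord0 addr0.
have nh0 : 0 <= n%:R * h by rewrite mulr_ge0 ?ler0n ?ltW.
rewrite big_ord_recr /=; have [tnh|nht] := leP t (n%:R * h).
  by rewrite ramp_before // mulr0 scale0r addr0 IH ?t0 // ltnW.
rewrite (yS n) // ?(ltW nht) // {1}(IH (ltnW nN)) ?nh0 ?lexx // yE ?(ltnW nN) //.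
rewrite ramp_during //; last by rewrite (ltW nht) -{2}(mul1r h) -mulrDl natr1.
rewrite addrA; congr (_ + _ + _); apply: eq_bigr => i _.
have ih : i%:R * h + h <= n%:R * h.
  by rewrite -{2}(mul1r h) -mulrDl natr1 ler_pM2r // ler_nat.
by rewrite !ramp_after // (le_trans ih) // ltW.
Qed.

(** Discrete Gronwall: each step multiplies 1 + |y| by at most 1 + h c <= exp(h c). *)
Lemma euler_growth c h x n : 0 < c -> 0 < h ->
    (forall z, enorm (f z) <= c * (1 + enorm z)) ->
  1 + enorm (euler f h x n) <= expR (n%:R * (h * c)) * (1 + enorm x).
Proof.
move=> c0 h0 fc; elim: n => [|n IH]; first by rewrite mul0r expR0 mul1r.
rewrite -natr1 mulrDl mul1r (addrC (n%:R * _)) expRD -mulrA.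
apply: (@le_trans _ _ ((1 + h * c) * (1 + enorm (euler f h x n)))).
  have : enorm (euler f h x n.+1) <=
      enorm (euler f h x n) + h * (c * (1 + enorm (euler f h x n))).
    rewrite (le_trans (enormD _ _)) // lerD2l enormZ gtr0_norm //.
    by rewrite ler_pM2l.
  by rewrite mulrDl mul1r mulrA; lra.
apply: ler_pM => //; last exact: expR_ge1Dx.
  by rewrite addr_ge0 // mulr_ge0 // ltW.
by rewrite addr_ge0 ?enorm_ge0.
Qed.

(** Each of the N products enters with weight h, so errors add up to the factor N h, which is the
    fixed time horizon in the application. *)
Lemma euler_approx_bound m N h x V : 0 < h ->
    (forall n, (n < N)%N -> enorm (f (euler f h x n)) <= V) ->
  (forall t, enorm (x + \sum_(n < N) (h * ramp (n%:R * h) h t) *: f (euler f h x n)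
      - euler_approx f m N h t x)
    <= N%:R * h * (Num.sqrt d%:R * (2^-1 ^+ m * (1 + V ^+ 3)))) /\
  (forall t, enorm (euler_approx f m N h t x)
    <= enorm x + N%:R * h * (Num.sqrt d%:R * (1 + V))).
Proof.
move=> h0 fV; split => t.
  rewrite /euler_approx opprD addrACA subrr add0r -sumrB -mulrA.
  apply: (@enorm_sum _ _ N (fun n => (h * ramp (n%:R * h) h t) *: f (euler f h x n) -
    h *: mul_vec m (ramp (n%:R * h) h t) (f (euler f h x n)))) => n nN.
  rewrite -scalerA -scalerBr enormZ gtr0_norm // ler_pM2l //.
  apply: enorm_le_coord => i; rewrite !mxE distrC.
  set v := f _ _ _; have [+ _] := mul_net_bound m v (ramp_itv (n%:R * h) t h0).
  move=> /le_trans; apply; rewrite ler_pM2l ?exprn_gt0 ?invr_gt0 // lerD2l.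
  apply: lerXn2r; rewrite ?nnegrE //; first exact: le_trans (enorm_ge0 _) (fV n nN).
  exact: le_trans (coord_le_enorm _ _) (fV n nN).
rewrite /euler_approx (le_trans (enormD _ _)) // lerD2l -mulrA.
apply: (@enorm_sum _ _ N
  (fun n => h *: mul_vec m (ramp (n%:R * h) h t) (f (euler f h x n)))) => n nN.
rewrite enormZ gtr0_norm // ler_pM2l //; apply: enorm_le_coord => i; rewrite !mxE.
set v := f _ _ _; have [_] := mul_net_bound m v (ramp_itv (n%:R * h) t h0).
move=> /le_trans; apply; rewrite lerD2l.
exact: le_trans (coord_le_enorm _ _) (fV n nN).
Qed.

End EulerScheme.

(** * Choice of the accuracy and auxiliary inequalities *)

Lemma half_pow_le {R : realType} {eps : R} : 0 < eps <= 1 ->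
  exists m : nat, 2^-1 ^+ m <= eps /\ m%:R <= 2 * `|ln eps| + 1.
Proof.
move=> /andP[e0 e1]; have l0 := normr_ge0 (ln eps).
exists (Num.trunc (2 * `|ln eps|)).+1.
have /andP[t1 t2] := truncn_itv (mulr_ge0 (ler0n R 2) l0); split; last first.
  by rewrite -natr1 lerD2r.
set m := (Num.trunc _).+1 in t2 *.
(* 1/2 <= exp(-1/2) follows from 1 + x <= exp(x) at x = -1/2; hence m >= 2 |ln eps| suffices. *)
apply: (@le_trans _ _ (expR (- 2^-1 * m%:R))).
  rewrite expRM_natr lerXn2r ?nnegrE ?expR_ge0 ?invr_ge0 //.
  by apply: le_trans (expR_ge1Dx _); lra.
rewrite -[leRHS](lnK e0) ler_expR.
have : ln eps <= 0 by exact: ln_le0.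
by move=> l; move: t2; rewrite ler0_norm //; lra.
Qed.

(** Membership in C identifies the dimensions, after which the casts in [map_at] are identities. *)
Lemma in_C_layers {R : realType} {d : nat} {Phi : network R} :
  in_C d d (realization Phi) ->
  exists s : layers R d d,
    (forall x, map_at d (realization Phi) x = layers_fun s x) /\
    num_params Phi = layers_size s.
Proof.
case: Phi => a b a0 b0 s [/= ad bd _]; subst a b.
by exists s; split=> // x; rewrite /map_at /= !conform_mx_id.
Qed.

(** Lets the sum of three constants serve in all three estimates. *)
Lemma scaled_sum_le {R : realFieldType} {C1 C2 C3 B : R} :
  0 <= C1 -> 0 <= C2 -> 0 <= C3 -> 0 <= B ->
  [/\ C1 * B <= (C1 + C2 + C3) * B, C2 * B <= (C1 + C2 + C3) * B
    & C3 * B <= (C1 + C2 + C3) * B].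
Proof. by move=> *; split; rewrite ler_wpM2r //; lra. Qed.

(** The difference of the two sides is 3 (1 + r) (1 - r)^2. *)
Lemma cube_1D_le {R : realFieldType} {r : R} : 0 <= r ->
  (1 + r) ^+ 3 <= 4 * (1 + r ^+ 3).
Proof.
move=> r0; rewrite -subr_ge0.
have -> : 4 * (1 + r ^+ 3) - (1 + r) ^+ 3 = 3 * ((1 + r) * (1 - r) ^+ 2) by ring.
by rewrite mulr_ge0 // mulr_ge0 ?sqr_ge0 // addr_ge0.
Qed.

(** * Assembly of the estimates *)

Theorem theorem1p1 (R : realType) (c T delta : R)
    (c_gt0 : 0 < c) (T_gt0 : 0 < T) (delta_gt0 : 0 < delta)
    (Phi : nat -> network R)
    (Phi_C : forall d : nat, (0 < d)%N -> in_C d d (realization (Phi d)))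
    (Phi_growth : forall d : nat, (0 < d)%N -> forall x : 'cV[R]_d,
      enorm (map_at d (realization (Phi d)) x) <= c * (1 + enorm x))
    (Phi_size : forall d : nat, (0 < d)%N ->
      (num_params (Phi d))%:R <= c * d%:R `^ delta)
    (Y : forall d N : nat, R -> 'cV[R]_d -> 'cV[R]_d)
    (Y_init : forall d N : nat, (0 < d)%N -> (0 < N)%N ->
      forall x : 'cV[R]_d, Y d N 0 x = x)
    (Y_step : forall d N : nat, (0 < d)%N -> (0 < N)%N ->
      forall n : nat, (n < N)%N ->
      forall t : R, n%:R * T / N%:R <= t <= n.+1%:R * T / N%:R ->
      forall x : 'cV[R]_d,
        Y d N t x = Y d N (n%:R * T / N%:R) x
          + (t - n%:R * T / N%:R)
            *: map_at d (realization (Phi d)) (Y d N (n%:R * T / N%:R) x)) :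
  exists (C : R) (Psi : R -> nat -> nat -> network R),
    [/\ forall (eps : R) (d N : nat), 0 < eps <= 1 -> (0 < d)%N -> (0 < N)%N ->
          in_C d.+1 d (realization (Psi eps d N)),
        forall (eps : R) (d N : nat), 0 < eps <= 1 -> (0 < d)%N -> (0 < N)%N ->
          forall (t : R) (x : 'cV[R]_d), 0 <= t <= T ->
          enorm (Y d N t x
                 - map_at d (realization (Psi eps d N)) (time_space t x))
          <= C * d%:R `^ (1 / 2) * N%:R `^ (3 / 2) * eps * (1 + enorm x ^+ 3),
        forall (eps : R) (d N : nat), 0 < eps <= 1 -> (0 < d)%N -> (0 < N)%N ->
          forall (t : R) (x : 'cV[R]_d), 0 <= t <= T ->
          enorm (map_at d (realization (Psi eps d N)) (time_space t x))
          <= C * d%:R `^ (1 / 2) * N%:R * (1 + enorm x ^+ 2)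
      & forall (eps : R) (d N : nat), 0 < eps <= 1 -> (0 < d)%N -> (0 < N)%N ->
          (num_params (Psi eps d N))%:R
          <= C * d%:R `^ (16 + 8 * delta) * N%:R ^+ 6 * (1 + `|ln eps| ^+ 2)].
Proof.
(* By [euler_growth], K (1 + |x|) bounds 1 + |y_n| at all grid points, hence c K (1 + |x|) bounds f
   there. *)
pose K := expR (c * T); have K0 : 0 < K by exact: expR_gt0.
have cK0 : 0 < c * K by rewrite mulr_gt0.
have cK30 : 0 < (c * K) ^+ 3 by rewrite exprn_gt0.
(* Constants for error, growth and size: the 4 is from [cube_1D_le], the outer 2 in [C2] from 1 + r
   <= 2 (1 + r^2), and 1440 = 240 * 6 from [euler_layers] and m + 4 <= 6 (1 + L^2). *)
pose C1 := T * (1 + 4 * (c * K) ^+ 3).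
pose C2 := 2 * (1 + T * (1 + c * K)).
pose C3 := 1440 * c ^+ 3.
have C10 : 0 <= C1 by rewrite mulr_ge0 ?(ltW T_gt0) //; lra.
have C20 : 0 <= C2.
  have : 0 <= T * (1 + c * K) by rewrite mulr_ge0 ?(ltW T_gt0) //; lra.
  by rewrite /C2; lra.
have C30 : 0 <= C3 := mulr_ge0 (ler0n R 1440) (exprn_ge0 3 (ltW c_gt0)).
pose C := C1 + C2 + C3; exists C.
(* All four claims for one index triple, so that a single use of choice yields the family. *)
pose good (p : R * nat * nat) (Psi : network R) : Prop :=
  let: (eps, d, N) := p in 0 < eps <= 1 -> (0 < d)%N -> (0 < N)%N ->
  [/\ in_C d.+1 d (realization Psi),
      forall (t : R) (x : 'cV[R]_d), 0 <= t <= T ->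
        enorm (Y d N t x - map_at d (realization Psi) (time_space t x))
        <= C * d%:R `^ (1 / 2) * N%:R `^ (3 / 2) * eps * (1 + enorm x ^+ 3),
      forall (t : R) (x : 'cV[R]_d), 0 <= t <= T ->
        enorm (map_at d (realization Psi) (time_space t x))
        <= C * d%:R `^ (1 / 2) * N%:R * (1 + enorm x ^+ 2)
    & (num_params Psi)%:R
        <= C * d%:R `^ (16 + 8 * delta) * N%:R ^+ 6 * (1 + `|ln eps| ^+ 2)].
suff /choice[Psi PsiP] : forall p, exists Psi, good p Psi.
  by exists (fun eps d N => Psi (eps, d, N)); split=> eps d N e01 d0 N0;
    have [] := PsiP (eps, d, N) e01 d0 N0.
move=> [[eps d] N]; rewrite /good.
(* Outside the admissible indices nothing is claimed and [Phi 0] is a placeholder. *)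
have [e01|] := boolP (0 < eps <= 1); last by exists (Phi 0%N).
have [d0|] := boolP (0 < d)%N; last by exists (Phi 0%N).
have [N0|] := boolP (0 < N)%N; last by exists (Phi 0%N).
have [s [sE sP]] := in_C_layers (Phi_C _ d0).
have [m [m_eps m_ln]] := half_pow_le e01.
pose h := T / N%:R.
have NR0 : 0 < N%:R :> R by rewrite ltr0n.
have h0 : 0 < h by rewrite divr_gt0.
have Nh : N%:R * h = T by rewrite mulrC divfK ?gt_eqF.
have [s' [s'E s'P]] := euler_layers m s h d0 N0.
exists (Network (ltn0Sn d) d0 s') => _ _ _.
set Psi := Network _ _ _.
have PsiE t x : map_at d (realization Psi) (time_space t x) =
    euler_approx (layers_fun s) m N h t x.
  by rewrite /map_at /= !conform_mx_id s'E.
have dR1 : 1 <= d%:R :> R by rewrite ler1n.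
have NR1 : 1 <= N%:R :> R by rewrite ler1n.
have d12 : d%:R `^ (1 / 2) = Num.sqrt d%:R :> R by rewrite div1r powR12_sqrt.
have sd1 : 1 <= Num.sqrt d%:R :> R by rewrite -{1}sqrtr1 ler_wsqrtr.
have fV x n : (n < N)%N ->
    enorm (layers_fun s (euler (layers_fun s) h x n)) <= c * K * (1 + enorm x).
  move=> nN; rewrite -sE (le_trans (Phi_growth _ d0 _)) // -mulrA ler_pM2l //.
  have fc z : enorm (layers_fun s z) <= c * (1 + enorm z).
    by rewrite -sE; exact: Phi_growth.
  apply: (le_trans (euler_growth x n c_gt0 h0 fc)).
  (* As n < N, the exponent n h c is at most c T. *)
  rewrite ler_wpM2r ?addr_ge0 ?enorm_ge0 // ler_expR mulrA mulrC ler_pM2l //.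
  by rewrite -[leRHS]Nh ler_pM2r // ler_nat ltnW.
split.
- by split=> //; exact: continuous_layers_fun.
- move=> t x tT; rewrite PsiE d12; set r := enorm x.
  have r0 : 0 <= r by exact: enorm_ge0.
  have -> : Y d N t x = x + \sum_(n < N) (h * ramp (n%:R * h) h t) *:
      layers_fun s (euler (layers_fun s) h x n).
    apply: (euler_interpolation (y := fun t => Y d N t x) h0) => [|n nN u|].
    + exact: Y_init.
    + by rewrite -sE /h !mulrA => ?; exact: Y_step.
    + by rewrite Nh.
  have [e _] := euler_approx_bound m h0 (@fV x).
  apply: (le_trans (e t)); rewrite Nh.
  set V := c * K * (1 + r).
  have V3 : 1 + V ^+ 3 <= (1 + 4 * (c * K) ^+ 3) * (1 + r ^+ 3).
    rewrite /V exprMn; have := cube_1D_le r0; have := exprn_ge0 3 r0.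
    move: cK30; move: ((c * K) ^+ 3) ((1 + r) ^+ 3) (r ^+ 3) => u v w u0 w0 vw.
    have : u * v <= u * (4 * (1 + w)) by rewrite ler_pM2l.
    by nra.
  have V0 : 0 <= 1 + V ^+ 3.
    by rewrite addr_ge0 // exprn_ge0 // mulr_ge0 ?(ltW cK0) // addr_ge0.
  have e0 : 0 <= eps by case/andP: e01 => /ltW.
  pose B := Num.sqrt d%:R * (eps * (1 + r ^+ 3)).
  have B0 : 0 <= B by rewrite !mulr_ge0 ?sqrtr_ge0 // addr_ge0 // exprn_ge0.
  apply: (@le_trans _ _ (C1 * B)).
    have -> : C1 * B = T * (Num.sqrt d%:R * (eps *
      ((1 + 4 * (c * K) ^+ 3) * (1 + r ^+ 3)))) by rewrite /C1 /B; ring.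
    rewrite ler_pM2l // ler_wpM2l ?sqrtr_ge0 //.
    apply: (@le_trans _ _ (eps * (1 + V ^+ 3))); first by rewrite ler_wpM2r.
    by rewrite ler_wpM2l.
  have [+ _ _] := scaled_sum_le C10 C20 C30 B0; rewrite -/C => /le_trans; apply.
  have -> : C * Num.sqrt d%:R * N%:R `^ (3 / 2) * eps * (1 + r ^+ 3) =
    C * B * N%:R `^ (3 / 2) by rewrite /B; ring.
  (* The bound so far is uniform in N; the factor N^(3/2) >= 1 enters here. *)
  rewrite ler_peMr //; first by rewrite mulr_ge0 // !addr_ge0.
  by rewrite -[leLHS](powRr0 N%:R); apply: ler_powR; rewrite // divr_ge0.
- move=> t x tT; rewrite PsiE d12; set r := enorm x.
  have r0 : 0 <= r by exact: enorm_ge0.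
  have [_ e] := euler_approx_bound m h0 (@fV x).
  apply: (le_trans (e t)); rewrite Nh -/r.
  pose B := Num.sqrt d%:R * (1 + r ^+ 2).
  have B0 : 0 <= B by rewrite mulr_ge0 ?sqrtr_ge0 // addr_ge0 // exprn_ge0.
  apply: (@le_trans _ _ (C2 * B)).
    rewrite /C2 /B.
    have r2 : 1 + r <= 2 * (1 + r ^+ 2) by nra.
    set q := Num.sqrt _ in sd1 *; set a := 1 + r ^+ 2 in r2 *.
    have a1 : 1 <= a by rewrite /a; nra.
    have qa : r <= q * (2 * a).
      by apply: (@le_trans _ _ (2 * a)); [lra|rewrite ler_peMl //; lra].
    have h1 : 1 + c * K * (1 + r) <= (1 + c * K) * (2 * a).
      by move: (c * K) cK0 => u u0; nra.
    have h2 : T * (q * (1 + c * K * (1 + r))) <= T * (q * ((1 + c * K) * (2 * a))).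
      by rewrite ler_pM2l // ler_pM2l //; lra.
    have -> : 2 * (1 + T * (1 + c * K)) * (q * a) =
      q * (2 * a) + T * (q * ((1 + c * K) * (2 * a))) by ring.
    exact: lerD.
  have [_ + _] := scaled_sum_le C10 C20 C30 B0; rewrite -/C => /le_trans; apply.
  have -> : C * Num.sqrt d%:R * N%:R * (1 + r ^+ 2) = C * B * N%:R.
    by rewrite /B; ring.
  by rewrite ler_peMr // mulr_ge0 // !addr_ge0.
- rewrite /num_params /=; set L := `|ln eps|; rewrite -/L in m_ln.
  have L0 : 0 <= L by exact: normr_ge0.
  pose D : R := d%:R `^ delta.
  have D0 : 0 <= D by exact: powR_ge0.
  pose B := d%:R `^ (16 + 8 * delta) * N%:R ^+ 6 * (1 + L ^+ 2).
  have L20 : 0 <= 1 + L ^+ 2 by rewrite addr_ge0 // exprn_ge0.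
  have B0 : 0 <= B by rewrite !mulr_ge0 ?powR_ge0 ?exprn_ge0.
  have [_ _] := scaled_sum_le C10 C20 C30 B0.
  have -> : (C1 + C2 + C3) * B =
    C * d%:R `^ (16 + 8 * delta) * N%:R ^+ 6 * (1 + L ^+ 2) by rewrite /C /B; ring.
  apply: le_trans.
  have : (layers_size s')%:R <= (240 * N * (m + 4) * layers_size s ^ 3)%:R :> R.
    by rewrite ler_nat.
  move=> /le_trans; apply; rewrite natrM natrX 2!natrM natrD.
  have Pc : (layers_size s)%:R <= c * D by rewrite -sP; exact: Phi_size.
  (* The cube gives d^(3 delta), and d >= 1 with 3 delta <= 16 + 8 delta. *)
  have P3 : (layers_size s)%:R ^+ 3 <= c ^+ 3 * d%:R `^ (16 + 8 * delta).
    apply: (@le_trans _ _ ((c * D) ^+ 3)).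
      by rewrite lerXn2r ?nnegrE // mulr_ge0 // ltW.
    rewrite exprMn ler_pM2l ?exprn_gt0 // -powR_mulrn // -powRrM.
    by apply: ler_powR => //; lra.
  (* From m <= 2 L + 1 and 2 L + 5 <= 6 (1 + L^2). *)
  have m4 : m%:R + 4 <= 6 * (1 + L ^+ 2) by nra.
  have N6 : N%:R <= N%:R ^+ 6 :> R by rewrite ler_eXnr.
  have -> : C3 * B = 240 * N%:R ^+ 6 * (6 * (1 + L ^+ 2)) *
    (c ^+ 3 * d%:R `^ (16 + 8 * delta)) by rewrite /C3 /B; ring.
  move: 240 (ler0n R 240) => q q0.
  apply: ler_pM P3; rewrite ?exprn_ge0 ?mulr_ge0 ?addr_ge0 ?ler0n //.
  apply: ler_pM m4; rewrite ?mulr_ge0 ?addr_ge0 ?ler0n //.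
  by rewrite ler_wpM2l.
Qed.
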